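(* For every integer $n\ge 0$, let $\mathcal{H}M_n$ denote the total number of humps over all Motzkin paths of length $n$, and let \[ S(2,1;n)=\sum_{\lambda} f^\lambda, \] where the sum is over all partitions $\lambda=(\lambda_1,\lambda_2,\ldots)$ of $n$ with $\lambda_3\le 1$. Then \[ \mathcal{H}M_n=S(2,1;n)-1. \]
   Context: For a partition $\lambda$, $f^\lambda$ denotes the number of standard Young tableaux of shape $\lambda$. A Motzkin path of length $n$ is a lattice path from $(0,0)$ to $(n,0)$ using flat-steps $(1,0)$, up-steps $(1,1)$ and down-steps $(1,-1)$ that never goes below the $x$-axis. A hump in a Motzkin path is a (contiguous) occurrence of an up-step, followed by zero or more flat-steps, followed by a down-step. *)

(* Defs.v *)
From HB Require Import structures.
From mathcomp Require Import all_boot all_order all_algebra.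

Set Implicit Arguments.
Unset Strict Implicit.
Unset Printing Implicit Defensive.

Import Order.TTheory GRing.Theory Num.Theory.

(** * Motzkin paths *)

Inductive step : predArgType := Flat | Up | Down.

Definition step_code (s : step) : option bool :=
  match s with Flat => None | Up => Some true | Down => Some false end.
Definition step_decode (o : option bool) : step :=
  match o with None => Flat | Some true => Up | Some false => Down end.
Lemma step_codeK : cancel step_code step_decode. Proof. by case. Qed.
HB.instance Definition _ := Finite.copy step (can_type step_codeK).

Definition step_dy (s : step) : int :=
  match s with Flat => 0%R | Up => 1%R | Down => (-1)%R end.

(* Every step advances the abscissa by 1, so a path from (0,0) to (n,0) is a
   word of n steps, and it visits the points (k, height p k) for k <= n. *)
Definition height (p : seq step) (k : nat) : int :=
  (\sum_(s <- take k p) step_dy s)%R.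

Definition is_motzkin n (p : n.-tuple step) : bool :=
  [forall k : 'I_n.+1, 0 <= height p k]%R && (height p n == 0%R).

Definition motzkin n : {set n.-tuple step} := [set p | is_motzkin p].

(* A contiguous occurrence Up Flat^k Down is determined by the positions
   i < j of its up-step and of its down-step. *)
Definition is_hump n (p : n.-tuple step) (i j : 'I_n) : bool :=
  [&& i < j, tnth p i == Up, tnth p j == Down
    & [forall m : 'I_n, (i < m < j) ==> (tnth p m == Flat)]].

Definition humps n (p : n.-tuple step) : nat :=
  #|[set ij : 'I_n * 'I_n | is_hump p ij.1 ij.2]|.

Definition HM (n : nat) : nat := \sum_(p in motzkin n) humps p.

(** * Partitions and standard Young tableaux *)

(* Parts are indexed from 0, so the i-th part of la is [nth 0 la i.-1].
   Trailing zeros are allowed; they add no cell to the diagram. *)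
Definition is_partition (n : nat) (la : seq nat) : bool :=
  sorted geq la && (sumn la == n).

Definition cell (la : seq nat) : finType :=
  {i : 'I_(size la) & 'I_(nth 0 la i)}.

Definition cell_row la (c : cell la) : nat := tag c.
Definition cell_col la (c : cell la) : nat := tagged c.

(* The entries are 0, ..., |la| - 1 instead of 1, ..., |la|. *)
Definition is_syt la (T : {ffun cell la -> 'I_(sumn la)}) : bool :=
  [&& [forall k, #|[set c | T c == k]| == 1],
      [forall c, forall d,
         (cell_row c == cell_row d) && (cell_col c < cell_col d)
           ==> (T c < T d)]
    & [forall c, forall d,
         (cell_col c == cell_col d) && (cell_row c < cell_row d)
           ==> (T c < T d)]].

Definition num_syt (la : seq nat) : nat :=
  #|[set T : {ffun cell la -> 'I_(sumn la)} | is_syt T]|.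

(* A partition of n has at most n nonzero parts, each at most n: padding with
   zeros to length n makes the partitions of n a set of n-tuples over 'I_n.+1,
   in which each partition of n is represented exactly once. *)
Definition parts n (t : n.-tuple 'I_n.+1) : seq nat := [seq val x | x <- t].

Definition partitions n : {set n.-tuple 'I_n.+1} :=
  [set t | is_partition n (parts t)].

Definition S21 (n : nat) : nat :=
  \sum_(t in partitions n | nth 0 (parts t) 2 <= 1) num_syt (parts t).

(* Main.v *)
Require Import Defs.
From mathcomp Require Import all_boot all_order all_algebra.
From mathcomp Require Import zify ring.

(** Both sides count the words of length l + 1 ending at height 1, for all
    l < n - 1, where a word is any sequence of the three steps.

    Humps: deleting the two extremal steps of a marked hump leaves a shorter
    Motzkin path with marked data, so that HM_n is the sum over l < n - 1 of
    (l + 1) M_l. Comparing coefficients in the derivative of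
    (1/X + 1 + X)^(l+1) shows that (l + 1) M_l is the number of words of length
    l + 1 ending at height 1.

    Tableaux: reading off the rows of the entries 1, ..., n, and writing Up for
    row 1, Down for row 2 and Flat for the lower rows (which are filled in
    order), turns the tableaux counted by S(2,1;n) into the words that stay
    nonnegative and have no Flat before their first Down. The word Up^n accounts
    for the "- 1"; the others are Up^(h+1) Down v with v nonnegative from height
    h. Let P(h, l) be the number of such v of length l, so that the number of
    words Up^(h+1) Down v is X(n - 2), where X(m) is the sum of P(h, l) over
    h + l = m. By reflection, P(h, l) - P(h-1, l) is the number of words of
    length l that end at height h or h + 1, and summing this over h + l = m
    counts the words of length m + 1 ending at height 1 according to their
    trailing run of h down-steps; so this number is X(m) - X(m - 1). *)

Set Implicit Arguments.
Unset Strict Implicit.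
Unset Printing Implicit Defensive.

Import GRing.Theory.

(** * Sums over words, split by the first letter *)

Section TupleSums.
Variables (R : nmodType) (T : finType).
Local Open Scope ring_scope.

Lemma big_tuple0 (F : 0.-tuple T -> R) : \sum_p F p = F [tuple].
Proof.
by rewrite (big_pred1 [tuple]) // => p; apply/esym/eqP/tuple0.
Qed.

Lemma big_tupleS n (F : n.+1.-tuple T -> R) :
  \sum_p F p = \sum_s \sum_(p : n.-tuple T) F [tuple of s :: p].
Proof.
rewrite pair_bigA /=.
rewrite (reindex (fun p : T * n.-tuple T => [tuple of p.1 :: p.2])) //=.
exists (fun p => (thead p, [tuple of behead p])) => [[s p]|p] _ /=.
  by rewrite theadE; congr (_, _); apply: val_inj.
by rewrite [RHS]tuple_eta.
Qed.
End TupleSums.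

Lemma big_step (R : nmodType) (F : step -> R) :
  (\sum_s F s = F Flat + F Up + F Down)%R.
Proof.
rewrite (bigD1 Flat) // (bigD1 Up) //= (bigD1 Down) //= big1 ?addr0 ?addrA //.
by case.
Qed.

Lemma big_stepsS (R : nmodType) n (F : n.+1.-tuple step -> R) :
  (\sum_p F p = \sum_(p : n.-tuple step) F [tuple of Flat :: p]
                + \sum_(p : n.-tuple step) F [tuple of Up :: p]
                + \sum_(p : n.-tuple step) F [tuple of Down :: p])%R.
Proof. by rewrite big_tupleS big_step. Qed.

(** * Trinomial coefficients *)

Section TrinomialCounts.
Local Open Scope ring_scope.

(* The number of step words of length l that end at height x. *)
Fixpoint trinom (l : nat) (x : int) : int :=
  if l is l'.+1 then trinom l' (x - 1) + trinom l' x + trinom l' (x + 1)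
  else (x == 0)%:Z.

Lemma trinomN l x : trinom l (- x) = trinom l x.
Proof.
elim: l x => [|l IH] x /=; first by rewrite oppr_eq0.
by rewrite -(IH (x - 1)) -(IH (x + 1)) -(IH x) !opprD opprK; ring.
Qed.

(* The coefficient of [X^(x-1)] in the derivative of [(1/X + 1 + X)^(l+1)]. *)
Lemma trinom_deriv l x :
  x * trinom l.+1 x = l.+1%:Z * (trinom l (x - 1) - trinom l (x + 1)).
Proof.
elim: l x => [|l IH] x.
  rewrite /= subr_eq0 addr_eq0; case: eqP => [->//|_].
  case: eqP => [->//|_]; case: eqP => [->//|_]; by rewrite mulr0.
have -> : trinom l.+2 x = trinom l.+1 (x - 1) + trinom l.+1 x + trinom l.+1 (x + 1) by [].
have e1 := IH (x - 1); have e2 := IH x; have e3 := IH (x + 1).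
(* Each factor is matched to the argument of its trinomial, as the induction hypothesis requires. *)
have -> : x * (trinom l.+1 (x - 1) + trinom l.+1 x + trinom l.+1 (x + 1))
  = (x - 1) * trinom l.+1 (x - 1) + x * trinom l.+1 x + (x + 1) * trinom l.+1 (x + 1)
    + (trinom l.+1 (x - 1) - trinom l.+1 (x + 1)) by ring.
have -> : l.+2%:Z = l.+1%:Z + 1 by lia.
rewrite e1 e2 e3 /= !subrK !addrK.
ring.
Qed.

(* Classify the words by the number [h] of trailing down-steps. *)
Lemma trinom_last_non_down l y :
  trinom l.+1 (y.+1%:Z) =
  \sum_(h < l.+1) (trinom (l - h) (y + h)%:Z + trinom (l - h) (y + h).+1%:Z).
Proof.
elim: l y => [|l IH] y.
  by rewrite big_ord1 addn0 subn0 /=; lia.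
have -> : trinom l.+2 y.+1%:Z =
   trinom l.+1 y%:Z + trinom l.+1 y.+1%:Z + trinom l.+1 y.+2%:Z.
  have -> : y%:Z = y.+1%:Z - 1 by lia.
  by have -> : y.+2%:Z = y.+1%:Z + 1 by lia.
rewrite big_ord_recl addn0 subn0 (IH y.+1); congr (_ + _).
by apply: eq_bigr => h _; rewrite lift0 subSS addSnnS.
Qed.

(** * Motzkin paths and humps *)

(* [to_axis h p]: started at height h, the word p stays nonnegative and ends at
   height 0. *)
Fixpoint to_axis (h : nat) (p : seq step) : bool :=
  match p with
  | [::] => h == 0%N
  | Flat :: q => to_axis h q
  | Up :: q => to_axis h.+1 q
  | Down :: q => if h is h'.+1 then to_axis h' q else false
  end.

Fixpoint flats_then_down (p : seq step) : bool :=
  match p with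
  | Flat :: q => flats_then_down q
  | Down :: _ => true
  | _ => false
  end.

Fixpoint nhumps (p : seq step) : nat :=
  if p is s :: q then ((s == Up) && flats_then_down q + nhumps q)%N else 0%N.

Definition axis_paths h l : int := \sum_(p : l.-tuple step) (to_axis h p)%:Z.
Definition axis_humps h l : int :=
  \sum_(p : l.-tuple step) (to_axis h p)%:Z * (nhumps p)%:Z.

(** Reflection principle: the subtracted term counts the words from height [h] to 0 that reach
    height -1. *)
Lemma axis_pathsE h l : axis_paths h l = trinom l h%:Z - trinom l (h%:Z + 2).
Proof.
rewrite /axis_paths; elim: l h => [|l IH] h.
  by rewrite big_tuple0 /=; lia.
rewrite big_stepsS /= !IH.
case: h => [|h].
  rewrite big1 // (_ : 0%:Z - 1 = - 1) // trinomN.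
  by rewrite (_ : 0%:Z + 2 - 1 = 1) // (_ : 1%:Z + 2 = 0%:Z + 2 + 1) //; ring.
rewrite IH.
have -> : h.+1%:Z - 1 = h by lia.
have -> : h.+1%:Z + 1 = h.+2 by lia.
have -> : h.+1%:Z + 2 - 1 = h%:Z + 2 by lia.
have -> : h.+1%:Z + 2 + 1 = h.+2%:Z + 2 by lia.
ring.
Qed.

(** The flats and the down-step completing a hump are cut off; [k] is the length of what remains,
    which starts at height [h]. *)
Lemma sum_flats_then_down h l :
  \sum_(p : l.-tuple step) (to_axis h.+1 p)%:Z * (flats_then_down p)%:Z
    = \sum_(k < l) axis_paths h k.
Proof.
elim: l => [|l IH]; first by rewrite big_tuple0 big_ord0.
rewrite big_stepsS /= IH big_ord_recr /= [X in _ + X + _]big1 ?addr0; last first.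
  by move=> p _; rewrite mulr0.
by congr (_ + _); apply: eq_bigr => p _; rewrite mulr1.
Qed.

Lemma axis_pathsS h l : axis_paths h l.+1 =
  axis_paths h l + axis_paths h.+1 l + (if h is h'.+1 then axis_paths h' l else 0).
Proof.
rewrite /axis_paths big_stepsS /=; congr (_ + _).
by case: h => [|h] //; rewrite big1.
Qed.

(** The last sum accounts for a hump whose up-step is the first step. *)
Lemma axis_humpsS h l : axis_humps h l.+1 =
  axis_humps h l + axis_humps h.+1 l + (if h is h'.+1 then axis_humps h' l else 0)
  + \sum_(k < l) axis_paths h k.
Proof.
rewrite -sum_flats_then_down /axis_humps big_stepsS /= [RHS]addrAC; congr (_ + _); last first.
  by case: h => [|h] //; rewrite big1 // => p _; rewrite mul0r.
rewrite -[RHS]addrA -[X in _ = _ + X]big_split; congr (_ + _); apply: eq_bigr => p _.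
by rewrite /= PoszD mulrDr addrC.
Qed.

(* Deleting the two extremal steps of a marked hump leaves a path with one of its
   vertices and some of the flat steps that follow it marked. *)
Lemma axis_humpsE h l :
  axis_humps h l = \sum_(k < l.-1) k.+1%:Z * axis_paths h k.
Proof.
elim: l h => [|l IH] h; first by rewrite /axis_humps big_tuple0 mulr0 big_ord0.
rewrite axis_humpsS !IH /=.
have -> : (if h is h'.+1 then axis_humps h' l else 0) =
   \sum_(k < l.-1) k.+1%:Z * (if h is h'.+1 then axis_paths h' k else 0).
  by case: h => [|h]; [rewrite big1 // => k _; rewrite mulr0 | exact: IH].
rewrite -!big_split /=.
(* After reindexing, the first sum gives [axis_paths h k] the weight [k], and the second sum adds 1
   to it. *)
under eq_bigr do rewrite -!mulrDr -axis_pathsS.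
case: l {IH} => [|l]; first by rewrite !big_ord0.
rewrite big_ord_recl [RHS]big_ord_recl /= mul1r addrCA; congr (_ + _).
rewrite -big_split; apply: eq_bigr => k _ /=.
by rewrite /bump /= add1n -[k.+2]addn1 PoszD mulrDl mul1r.
Qed.

(** The difference in [trinom_deriv] at [x = 1] is the reflection formula at height 0. *)
Lemma axis_paths0 l : l.+1%:Z * axis_paths 0 l = trinom l.+1 1.
Proof.
by rewrite axis_pathsE add0r -[RHS]mul1r trinom_deriv subrr.
Qed.

Lemma all_iotaS (a : pred nat) m n :
  all a (iota m.+1 n) = all (fun k => a k.+1) (iota m n).
Proof. by rewrite -add1n iotaDl all_map. Qed.

Lemma all_iota0S (a : pred nat) n :
  all a (iota 0 n.+1) = a 0%N && all (fun k => a k.+1) (iota 0 n).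
Proof. by rewrite /= all_iotaS. Qed.

Lemma height_cons s p k : height (s :: p) k.+1 = step_dy s + height p k.
Proof. by rewrite /height /= big_cons. Qed.

Lemma to_axisE h p :
  to_axis h p = all (fun k => 0 <= h%:Z + height p k) (iota 0 (size p).+1)
                && (h%:Z + height p (size p) == 0).
Proof.
elim: p h => [|s p IH] h.
  by rewrite /= /height /= big_nil addr0; lia.
have -> : all (fun k => 0 <= h%:Z + height (s :: p) k) (iota 0 (size (s :: p)).+1)
   = all (fun k => 0 <= h%:Z + step_dy s + height p k) (iota 0 (size p).+1).
  rewrite (all_iota0S _ (size p).+1) {1}/height take0 big_nil addr0 le0z_nat andTb.
  apply: eq_all => k.
  by rewrite height_cons addrA.
rewrite [size _]/= height_cons addrA.
case: s => /=; rewrite ?[to_axis _ _]IH.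
- by rewrite addr0.
- by have -> : h%:Z + 1 = h.+1%:Z by lia.
case: h => [|h].
  by rewrite /height take0 big_nil.
by have -> : h.+1%:Z + -1 = h%:Z by lia.
Qed.

Lemma is_motzkinE n (p : n.-tuple step) : is_motzkin p = to_axis 0 p.
Proof.
rewrite to_axisE size_tuple add0r /is_motzkin; congr (_ && _).
apply/forallP/allP => [H k|H k].
  by rewrite mem_iota add0n => kn; rewrite add0r (H (Ordinal kn)).
by rewrite -[height p k]add0r H // mem_iota /=.
Qed.

Definition hump_at (p : seq step) (i j : nat) : bool :=
  [&& (i < j)%N, nth Flat p i == Up, nth Flat p j == Down
    & all (fun m => nth Flat p m == Flat) (iota i.+1 (j - i.+1))].

Lemma is_humpE n (p : n.-tuple step) i j : is_hump p i j = hump_at p i j.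
Proof.
rewrite /is_hump /hump_at !(tnth_nth Flat).
case: ltnP => //= ij; congr [&& _, _ & _].
apply/forallP/allP => [H m|H m].
  rewrite mem_iota subnKC // => /andP[im mj].
  have := H (Ordinal (ltn_trans mj (ltn_ord j))).
  by rewrite (tnth_nth Flat) /= im mj.
by apply/implyP => imj; rewrite (tnth_nth Flat) H // mem_iota subnKC.
Qed.

Lemma flats_then_downE p :
  (\sum_(j < size p)
     ((nth Flat p j == Down) && all (fun m => nth Flat p m == Flat) (iota 0 j)))%N
  = flats_then_down p.
Proof.
elim: p => [|s p IH]; first by rewrite big_ord0.
rewrite big_ord_recl.
under eq_bigr do rewrite lift0 all_iota0S andbCA /=.
by case: s => /=; [exact: IH | rewrite big1 | rewrite big1].
Qed.

Lemma sum_hump_at p :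
  (\sum_(i < size p) \sum_(j < size p) hump_at p i j)%N = nhumps p.
Proof.
elim: p => [|s p IH]; first by rewrite big_ord0.
rewrite big_ord_recl [RHS]/=; congr (_ + _)%N.
  rewrite big_ord_recl add0n.
  under eq_bigr do rewrite lift0 /hump_at subSS subn0 all_iotaS /=.
  case: (s == Up) => /=; last by rewrite big1.
  exact: flats_then_downE.
rewrite -IH; apply: eq_bigr => i _; rewrite big_ord_recl add0n.
by apply: eq_bigr => j _; rewrite !lift0 /hump_at ltnS subSS all_iotaS.
Qed.

Lemma humpsE n (p : n.-tuple step) : humps p = nhumps p.
Proof.
rewrite -sum_hump_at size_tuple /humps -sum1_card pair_bigA big_mkcond /=.
by apply: eq_bigr => ij _; rewrite inE -is_humpE; case: ifP.
Qed.

Lemma HME n : (HM n)%:Z = axis_humps 0 n.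
Proof.
rewrite /HM /axis_humps big_mkcond (big_morph Posz PoszD (erefl 0%:Z)) /=.
apply: eq_bigr => p _; rewrite inE is_motzkinE humpsE.
by case: ifP; rewrite ?mul1r ?mul0r.
Qed.

(** * Ballot words *)

(* Started at height h, the word p stays nonnegative and, unless b holds, its
   first flat step comes after its first down-step. *)
Fixpoint ballot_from (h : nat) (b : bool) (p : seq step) : bool :=
  match p with
  | [::] => true
  | Flat :: q => b && ballot_from h b q
  | Up :: q => ballot_from h.+1 b q
  | Down :: q => if h is h'.+1 then ballot_from h' true q else false
  end.

Definition ballot_words h b l : int := \sum_(p : l.-tuple step) (ballot_from h b p)%:Z.

Lemma ballot_words_trueS h l : ballot_words h true l.+1 =
  ballot_words h true l + ballot_words h.+1 true l
  + (if h is h'.+1 then ballot_words h' true l else 0).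
Proof.
rewrite /ballot_words big_stepsS /=; congr (_ + _).
by case: h => [|h] //; rewrite big1.
Qed.

Lemma ballot_words_falseS h l : ballot_words h false l.+1 =
  ballot_words h.+1 false l + (if h is h'.+1 then ballot_words h' true l else 0).
Proof.
rewrite /ballot_words big_stepsS /= big1 // add0r; congr (_ + _).
by case: h => [|h] //; rewrite big1.
Qed.

Lemma ballot_words0 h b : ballot_words h b 0 = 1.
Proof. by rewrite /ballot_words big_tuple0. Qed.

(** By reflection, [ballot_words h true l] counts the words of length [l] ending between [- h] and
    [h + 1]; passing from [h - 1] to [h] adds the two ends of this window. *)
Lemma ballot_words_diff h l :
  ballot_words h true l - (if h is h'.+1 then ballot_words h' true l else 0)
  = trinom l h%:Z + trinom l h.+1%:Z.
Proof.
elim: l h => [|l IH] h.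
  by case: h => [|h]; rewrite !ballot_words0 /=.
have tS (x : nat) : trinom l.+1 x.+1%:Z =
    trinom l x%:Z + trinom l x.+1%:Z + trinom l x.+2%:Z.
  have {1}-> : x%:Z = x.+1%:Z - 1 by lia.
  by have -> : x.+2%:Z = x.+1%:Z + 1 by lia.
case: h => [|[|h]].
- rewrite tS ballot_words_trueS /= (_ : 0%:Z - 1 = - 1%:Z) // (_ : 0%:Z + 1 = 1%:Z) // trinomN.
  have := IH 0%N; have := IH 1%N => /=; lia.
- rewrite !tS !ballot_words_trueS.
  have := IH 0%N; have := IH 1%N; have := IH 2%N => /=; lia.
- rewrite !tS !ballot_words_trueS.
  have := IH h.+3; have := IH h.+2; have := IH h.+1; lia.
Qed.

(** The 1 is the word of up-steps only; otherwise [j] up-steps precede the first down-step, which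
    leads to height [h + j]. *)
Lemma ballot_words_falseE h l :
  ballot_words h.+1 false l = 1 + \sum_(j < l) ballot_words (h + j) true (l.-1 - j).
Proof.
elim: l h => [|l IH] h; first by rewrite ballot_words0 big_ord0 addr0.
rewrite ballot_words_falseS IH big_ord_recl addn0 subn0 -addrA; congr (_ + _).
rewrite addrC; congr (_ + _); apply: eq_bigr => j _.
by rewrite lift0 addSnnS -subn1 -subnDA add1n.
Qed.

Lemma sum_ballot_words_true l :
  \sum_(j < l) ballot_words j true (l.-1 - j) = \sum_(k < l) trinom k.+1 1.
Proof.
elim: l => [|l IH]; first by rewrite !big_ord0.
rewrite [RHS]big_ord_recr -IH /= -[X in _ + X]/(trinom l.+1 1).
rewrite (trinom_last_non_down l 0).
(* The sum telescopes: the subtracted parts of these differences add up to the left-hand side for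
   [l]. *)
under [X in _ + X]eq_bigr do rewrite !add0n -ballot_words_diff.
rewrite [in X in _ + X]big_ord_recl /= subr0 big_ord_recl /=.
rewrite addrCA; congr (_ + _); rewrite -big_split; apply: eq_bigr => j _ /=.
by rewrite /bump /= add1n -subn1 -subnDA add1n addrC subrK.
Qed.

Lemma ballot_wordsE n : ballot_words 0 false n = 1 + axis_humps 0 n.
Proof.
rewrite axis_humpsE; case: n => [|l]; first by rewrite ballot_words0 big_ord0 addr0.
rewrite ballot_words_falseS addr0 ballot_words_falseE; congr (_ + _).
under eq_bigr do rewrite add0n.
rewrite sum_ballot_words_true; apply: eq_bigr => k _.
by rewrite axis_paths0.
Qed.

End TrinomialCounts.

(** * The ballot condition in terms of prefix counts *)

Lemma count_steps (p : seq step) :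
  size p = count_mem Up p + count_mem Down p + count_mem Flat p.
Proof. by elim: p => //= -[] p /=; lia. Qed.

Definition before (s : step) (p : seq step) (k : nat) : nat :=
  count_mem s (take k p).

(* The k-th letter of p may follow a prefix already preceded by u up-steps and d
   down-steps. *)
Definition ballot_step (u d : nat) (p : seq step) (k : nat) : bool :=
  match nth Flat p k with
  | Flat => 0 < d + before Down p k
  | Up => true
  | Down => d + before Down p k < u + before Up p k
  end.

(** The state of [ballot_from] summarizes the prefix already read: its height is [u - d], and the
    flag tells whether a down-step has occurred. *)
Lemma ballot_fromE u d p : d <= u ->
  ballot_from (u - d) (0 < d) p = all (ballot_step u d p) (iota 0 (size p)).
Proof.
elim: p u d => [|s p IH] u d //= le_du.
rewrite all_iotaS {1}/ballot_step /= /before take0 /= !addn0.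
have atS k : ballot_step u d (s :: p) k.+1 = ballot_step (u + (s == Up)) (d + (s == Down)) p k.
  by rewrite /ballot_step /before /= !addnA.
rewrite (eq_all atS).
case: s atS => /= _; rewrite ?addn0 ?addn1.
- by rewrite -IH.
- by rewrite -IH ?subSn // ltnW.
case: ltnP => [lt_du|le_ud].
  by rewrite (_ : u - d = (u - d.+1).+1) ?subnSK //= -IH.
by rewrite (_ : u - d = 0) //; apply/eqP; rewrite subn_eq0.
Qed.

Section Before.
Variable s : step.
Implicit Type p : seq step.

Lemma before0 p : before s p 0 = 0. Proof. by rewrite /before take0. Qed.

Lemma beforeS p k : k < size p ->
  before s p k.+1 = before s p k + (nth Flat p k == s).
Proof.
by move=> kp; rewrite /before (take_nth Flat kp) -cats1 count_cat /= addn0.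
Qed.

Lemma before_size p : before s p (size p) = count_mem s p.
Proof. by rewrite /before take_size. Qed.

Lemma leq_before p k l : k <= l -> before s p k <= before s p l.
Proof.
move=> kl; rewrite /before -(take_takel p kl).
by rewrite -[X in _ <= count_mem s X](cat_take_drop k) count_cat leq_addr.
Qed.

Lemma before_lt p k l : before s p k < before s p l -> k < l.
Proof. by apply: contraTT; rewrite -!leqNgt; apply: leq_before. Qed.

Lemma lt_before p k l : k < size p -> nth Flat p k = s -> k < l ->
  before s p k < before s p l.
Proof.
move=> kp pk kl; apply: leq_trans (leq_before p kl).
by rewrite beforeS // pk eqxx addn1.
Qed.

Lemma before_lt_count p k : k < size p -> nth Flat p k = s ->
  before s p k < count_mem s p.
Proof. by move=> kp pk; rewrite -before_size; apply: lt_before. Qed.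

Lemma before_inj p k l : k < size p -> nth Flat p k = s ->
  l < size p -> nth Flat p l = s -> before s p k = before s p l -> k = l.
Proof.
move=> kp pk lp pl e; case: (ltngtP k l) => // [kl|lk].
  by have := lt_before kp pk kl; rewrite e ltnn.
by have := lt_before lp pl lk; rewrite e ltnn.
Qed.

Lemma beforeE n (p : n.-tuple step) k :
  before s p k = \sum_(i < n) ((i < k) && (tnth p i == s)).
Proof.
transitivity (\sum_(i < size p) ((i < k) && (nth Flat p i == s))); last first.
  by rewrite size_tuple; apply: eq_bigr => i _; rewrite (tnth_nth Flat).
elim: {n p}(tval p) k => [|x p IH] k; first by rewrite big_ord0.
rewrite big_ord_recl; case: k => [|k]; first by rewrite before0 big1.
by rewrite /before /= -/(before s p k) IH.
Qed.
End Before.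

Definition ballot (p : seq step) : bool := all (ballot_step 0 0 p) (iota 0 (size p)).

Lemma ballot_nth p k : ballot p -> k < size p -> ballot_step 0 0 p k.
Proof. by move=> /allP bp kp; apply: bp; rewrite mem_iota. Qed.

Lemma ballot_le p k : ballot p -> k <= size p -> before Down p k <= before Up p k.
Proof.
move=> bp; elim: k => [|k IH] kp; first by rewrite !before0.
have := ballot_nth bp kp; rewrite !beforeS // /ballot_step.
by have := IH (ltnW kp); case: (nth Flat p k) => /=; lia.
Qed.

(** * Standard tableaux *)

Lemma nth_partition la i j : sorted geq la -> i <= j -> nth 0 la j <= nth 0 la i.
Proof.
move=> sla ij; case: (ltnP j (size la)) => [jla|]; last by move/(nth_default 0) ->.
have geq_trans : transitive geq by move=> y x z /= xy yz; apply: leq_trans xy.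
by apply: (sorted_leq_nth geq_trans leqnn 0 sla) => //; apply: leq_ltn_trans jla.
Qed.

Lemma nth_column la i : sorted geq la -> nth 0 la 0 <= 1 ->
  nth 0 la i = (i < sumn la).
Proof.
elim: la i => [|x la IH] i; first by rewrite !nth_nil.
move=> sla /= x1.
have le_x j : nth 0 la j <= x by apply: (@nth_partition (x :: la) 0 j.+1).
have := IH _ (path_sorted sla) (leq_trans (le_x 0) x1).
case: x x1 {sla IH} le_x => [|[|//]] _ le_x IH.
  (* With first part 0 all parts are 0; index [(sumn la).-1] gives [sumn la = 0], as it would
     otherwise carry a 1. *)
  have := IH (sumn la).-1; have := le_x (sumn la).-1; have := le_x i.-1.
  case: i => [|i] /=; first by lia.
  by have := IH i; lia.
case: i => [|i] //=; rewrite IH; lia.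
Qed.

Definition legs (la : seq nat) : nat := sumn (drop 2 la).

Lemma sumn_legs la : sumn la = nth 0 la 0 + nth 0 la 1 + legs la.
Proof. by case: la => [|x [|y la]]; rewrite /legs //= ?addn0 ?drop0 ?addnA. Qed.

(** From the third row on, the diagram is a single column. *)
Lemma nth_legs la i : sorted geq la -> nth 0 la 2 <= 1 ->
  nth 0 la i.+2 = (i < legs la).
Proof.
move=> sla la2; rewrite -nth_column ?nth_drop //.
exact: drop_sorted.
Qed.

(** * The cells of a diagram *)

Section Cells.
Variable la : seq nat.

Lemma cell_inj (c d : cell la) :
  cell_row c = cell_row d -> cell_col c = cell_col d -> c = d.
Proof.
case: c d => [i x] [j y]; rewrite /cell_row /cell_col /= => /ord_inj ij.
by case: j / ij y => y /ord_inj ->.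
Qed.

Lemma ltn_cell_col (c : cell la) : cell_col c < nth 0 la (cell_row c).
Proof. exact: ltn_ord. Qed.

Lemma ltn_cell_row (c : cell la) : cell_row c < size la.
Proof. exact: ltn_ord. Qed.

Lemma ex_cell i j : j < nth 0 la i ->
  exists c : cell la, cell_row c = i /\ cell_col c = j.
Proof.
move=> ji; case: (ltnP i (size la)) => [ila|]; last first.
  by move=> /(nth_default 0) e; rewrite e in ji.
by exists (Tagged (fun i : 'I_(size la) => 'I_(nth 0 la i)) (i := Ordinal ila) (Ordinal ji)).
Qed.

Lemma sum_cell (F : nat -> nat -> nat) :
  \sum_(c : cell la) F (cell_row c) (cell_col c)
  = \sum_(i < size la) \sum_(j < nth 0 la i) F i j.
Proof.
by rewrite (@sig_big_dep _ _ _ 'I_(size la) (fun i => 'I_(nth 0 la i)) xpredT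
              (fun _ => xpredT) (fun i j => F i j)).
Qed.

Lemma card_cell : #|{: cell la}| = sumn la.
Proof.
rewrite -sum1_card (sum_cell (fun _ _ => 1)) sumnE (big_nth 0) big_mkord.
by apply: eq_bigr => i _; rewrite sum1_card card_ord.
Qed.

Lemma sum_row r (P : pred nat) :
  \sum_(c : cell la) ((cell_row c == r) && P (cell_col c))
  = \sum_(j < nth 0 la r) P j.
Proof.
rewrite (sum_cell (fun i j => (i == r) && P j)).
case: (ltnP r (size la)) => [rla|rla]; last first.
  rewrite nth_default // big_ord0 big1 // => i _; rewrite big1 // => j _.
  by case: eqP => // e; rewrite -e leqNgt ltn_ord in rla.
rewrite (bigD1 (Ordinal rla)) //= eqxx [X in _ + X]big1 ?addn0 // => i ir.
by rewrite big1 // => j _; rewrite -val_eqE /= in ir; rewrite (negPf ir).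
Qed.

Lemma sum_ltn m k : \sum_(j < m) (j < k) = minn k m.
Proof.
elim: m => [|m IH]; first by rewrite big_ord0 minn0.
rewrite big_ord_recr /= IH; lia.
Qed.

Lemma sum_leg m k : \sum_(i < m) (1 < i < k) = minn k m - 2.
Proof.
elim: m => [|m IH]; first by rewrite big_ord0 minn0.
rewrite big_ord_recr /= IH; lia.
Qed.

End Cells.

(** * Tableaux and their row words *)

Definition row_step (i : nat) : step :=
  match i with 0 => Up | 1 => Down | _ => Flat end.

(* The row and column of the entry k in the tableau with row word p. *)
Definition locate (p : seq step) (k : nat) : nat * nat :=
  match nth Flat p k with
  | Flat => ((before Flat p k).+2, 0)
  | Up => (0, before Up p k)
  | Down => (1, before Down p k)
  end.

Lemma row_step_locate p k : row_step (locate p k).1 = nth Flat p k.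
Proof. by rewrite /locate; case: nth. Qed.

Lemma locate_ltn_row p k l : (locate p k).1 = (locate p l).1 ->
  (locate p k).2 < (locate p l).2 -> k < l.
Proof.
by rewrite /locate; case: (nth Flat p k); case: (nth Flat p l) => //= _; apply: before_lt.
Qed.

(** If [k] lies in one of the first two rows, the ballot condition at [l] puts more letters of that
    row before [l] than before [k]. *)
Lemma locate_ltn_col p k l : ballot p -> l < size p ->
  (locate p k).2 = (locate p l).2 -> (locate p k).1 < (locate p l).1 -> k < l.
Proof.
move=> bp lp; have := ballot_nth bp lp; have := ballot_le bp (ltnW lp).
rewrite /locate /ballot_step !add0n.
case: (nth Flat p k); case: (nth Flat p l) => //= le_l at_l ekl lt_kl.
- by apply: (@before_lt Flat p).
- by apply: (@before_lt Up p); rewrite ekl; apply: leq_trans le_l.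
- by apply: (@before_lt Up p); rewrite ekl.
- by apply: (@before_lt Down p); rewrite ekl.
Qed.

Section Tableaux.
Variable la : seq nat.
Hypotheses (la_sorted : sorted geq la) (la2 : nth 0 la 2 <= 1).
Let n := sumn la.
Implicit Type T : {ffun cell la -> 'I_n}.

(** For standard [T] every entry occupies a cell, so the default [Flat] is not reached. *)
Definition row_word T : n.-tuple step :=
  [tuple if [pick c | T c == k] is Some c then row_step (cell_row c) else Flat | k < n].

Lemma col_leg (c : cell la) : 1 < cell_row c -> cell_col c = 0.
Proof.
move=> rc; have := ltn_cell_col c.
have := leq_trans (nth_partition la_sorted rc) la2; lia.
Qed.

Section Standard.
Variable T : {ffun cell la -> 'I_n}.
Hypothesis stdT : is_syt T.

Lemma syt_inj : injective T.
Proof.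
case/and3P: stdT => /forallP T1 _ _ c d Tcd.
have /cards1P[e Te] := T1 (T c).
have : c \in [set e] by rewrite -Te inE.
have : d \in [set e] by rewrite -Te inE Tcd.
by rewrite !inE => /eqP-> /eqP->.
Qed.

Lemma syt_surj (k : 'I_n) : exists c, T c = k.
Proof.
case/and3P: stdT => /forallP T1 _ _.
have /cards1P[c Tc] := T1 k; exists c.
by apply/eqP; have := set11 c; rewrite -Tc inE.
Qed.

Lemma syt_row c d : cell_row c = cell_row d -> (T c < T d) = (cell_col c < cell_col d).
Proof.
case/and3P: stdT => _ /forallP Tr _.
have rowP e f : cell_row e = cell_row f -> cell_col e < cell_col f -> T e < T f.
  by move=> ef cef; have /forallP/(_ f)/implyP := Tr e; rewrite ef eqxx; apply.
move=> cd; case: (ltngtP (cell_col c)) => [lt|gt|/(cell_inj cd)->].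
- by rewrite rowP.
- by apply/negbTE; rewrite -leqNgt ltnW // rowP.
- exact: ltnn.
Qed.

Lemma syt_col c d : cell_col c = cell_col d -> (T c < T d) = (cell_row c < cell_row d).
Proof.
case/and3P: stdT => _ _ /forallP Tr.
have colP e f : cell_col e = cell_col f -> cell_row e < cell_row f -> T e < T f.
  by move=> ef cef; have /forallP/(_ f)/implyP := Tr e; rewrite ef eqxx; apply.
move=> cd; case: (ltngtP (cell_row c)) => [lt|gt|/cell_inj/(_ cd)->].
- by rewrite colP.
- by apply/negbTE; rewrite -leqNgt ltnW // colP.
- exact: ltnn.
Qed.

Lemma nth_row_word c : nth Flat (row_word T) (T c) = row_step (cell_row c).
Proof.
rewrite -tnth_nth tnth_mktuple; case: pickP => [d /eqP/syt_inj-> //|/(_ c)].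
by rewrite eqxx.
Qed.

Lemma sum_row_word (F : step -> nat -> nat) :
  \sum_(k < n) F (tnth (row_word T) k) k
  = \sum_c F (row_step (cell_row c)) (T c).
Proof.
rewrite (reindex T) /=; last first.
  by apply: onW_bij; apply: inj_card_bij syt_inj _; rewrite card_ord card_cell.
by apply: eq_bigr => c _; rewrite (tnth_nth Flat) nth_row_word.
Qed.

Lemma before_row_word s c : before s (row_word T) (T c)
  = \sum_d ((T d < T c) && (row_step (cell_row d) == s)).
Proof.
rewrite beforeE.
exact: (sum_row_word (fun s' k => (k < T c) && (s' == s) : nat)).
Qed.

Lemma row_step_eq r i : r < 2 -> (row_step i == row_step r) = (i == r).
Proof. by case: r => [|[|//]] _; case: i => [|[|i]]. Qed.

(** As rows increase, the smaller entries of the row of [c] are those to its left. *)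
Lemma before_row_word_arm c : cell_row c < 2 ->
  before (row_step (cell_row c)) (row_word T) (T c) = cell_col c.
Proof.
move=> rc; rewrite before_row_word.
transitivity (\sum_(d : cell la) ((cell_row d == cell_row c) && (cell_col d < cell_col c))).
  apply: eq_bigr => d _; rewrite row_step_eq // andbC.
  by case: eqP => //= /syt_row->.
rewrite (sum_row _ _ (fun j => j < cell_col c)) sum_ltn (minn_idPl _) //.
exact/ltnW/ltn_cell_col.
Qed.

Lemma before_row_word_leg c : 1 < cell_row c ->
  (before Flat (row_word T) (T c)).+2 = cell_row c.
Proof.
move=> rc; rewrite before_row_word.
transitivity (\sum_(d : cell la) (1 < cell_row d < cell_row c)).+2.
  congr _.+2; apply: eq_bigr => d _; rewrite andbC.
  case: (ltnP 1 (cell_row d)) => rd; last by case: (cell_row d) rd => [|[|]].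
  rewrite (syt_col (c := d)) ?col_leg //.
  by case: (cell_row d) rd => [|[|]].
rewrite (sum_cell _ (fun i _ => 1 < i < cell_row c)).
transitivity (\sum_(i < size la) (1 < i < cell_row c)).+2.
  congr _.+2; apply: eq_bigr => i _; rewrite sum_nat_const card_ord.
  (* Such a row has exactly one cell: at most one by [la2], at least one because [c] lies below
     it. *)
  case: (boolP (1 < i < _)) => [/andP[i1 ic]|_]; rewrite ?muln0 // muln1.
  have := nth_partition la_sorted i1; have := nth_partition la_sorted (ltnW ic).
  have := ltn_cell_col c; lia.
by rewrite sum_leg; have := ltn_cell_row c; lia.
Qed.

Lemma locate_row_word c : locate (row_word T) (T c) = (cell_row c, cell_col c).
Proof.
rewrite /locate nth_row_word.
have := @before_row_word_arm c; have := @before_row_word_leg c; have := @col_leg c.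
case: (cell_row c) => [|[|r]] /=; [by move=> _ _ -> | by move=> _ _ -> |].
by move=> -> // -> .
Qed.

(** As columns increase, the cell above a second-row cell supplies the extra up-step, and the
    second-row cell of the first column supplies a down-step before any flat step. *)
Lemma row_word_ballot : ballot (row_word T).
Proof.
apply/allP => k; rewrite mem_iota size_tuple add0n => /= kn.
have [c Tc] := syt_surj (Ordinal kn).
have -> : k = T c by rewrite Tc.
rewrite /ballot_step nth_row_word !add0n.
have sT d : T d < size (row_word T) by rewrite size_tuple.
have := nth_row_word c; have := @before_row_word_arm c; have := @col_leg c.
have := ltn_cell_col c.
case rc: (cell_row c) => [|[|r]] //= jc.
  move=> _ -> // _.
  have [|d [rd cd]] := @ex_cell la 0 (cell_col c).
    exact: leq_trans jc (nth_partition la_sorted _).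
  rewrite -{1}cd -(before_row_word_arm (c := d)) ?rd //=.
  by apply: lt_before; rewrite ?nth_row_word ?rd // syt_col ?rd ?rc.
move=> c0 _ _; have [|d [rd cd]] := @ex_cell la 1 (cell_col c).
  exact: leq_trans jc (nth_partition la_sorted _).
apply: leq_ltn_trans (leq0n (before Down (row_word T) (T d))) _.
by apply: lt_before; rewrite ?nth_row_word ?rd // syt_col ?rd ?rc.
Qed.

Lemma count_row_word r : r < 2 -> count_mem (row_step r) (row_word T) = nth 0 la r.
Proof.
move=> r2; rewrite -before_size beforeE size_tuple.
rewrite (sum_row_word (fun s' k => (k < n) && (s' == row_step r) : nat)).
transitivity (\sum_(c : cell la) ((cell_row c == r) && true)).
  by apply: eq_bigr => c _; rewrite ltn_ord andbT row_step_eq.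
by rewrite (sum_row _ _ xpredT) sum1_card card_ord.
Qed.

End Standard.

Lemma row_word_inj : {in [set T | is_syt T] &, injective row_word}.
Proof.
move=> T U; rewrite !inE => stdT stdU TU; apply/ffunP => c.
have [d Ud] := syt_surj stdU (T c).
have := locate_row_word stdT c; rewrite TU -Ud locate_row_word // => -[rdc cdc].
by rewrite -(cell_inj rdc cdc).
Qed.

(** [locate p] sends the entries injectively, hence bijectively, to the cells; the tableau is the
    inverse map. *)
Lemma row_word_onto (p : n.-tuple step) : ballot p ->
  count_mem Up p = nth 0 la 0 -> count_mem Down p = nth 0 la 1 ->
  exists2 T, is_syt T & row_word T = p.
Proof.
move=> bp pU pD.
have sp (k : 'I_n) : k < size p by rewrite size_tuple.
have pF : count_mem Flat p = legs la.
  have := sumn_legs la; rewrite -pU -pD -/n -[n in LHS](size_tuple p).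
  by rewrite count_steps => /addnI.
have [k|g gP] := @fin_all_exists _ (fun=> cell la)
  (fun (k : 'I_n) (c : cell la) => (cell_row c, cell_col c) = locate p k).
  have [|c [rc cc]] := @ex_cell la (locate p k).1 (locate p k).2; last first.
    by exists c; rewrite rc cc -surjective_pairing.
  rewrite /locate; case pk: nth => /=.
  - by rewrite nth_legs // -pF (before_lt_count (sp k)).
  - by rewrite -pU before_lt_count.
  - by rewrite -pD before_lt_count.
have gK (k : 'I_n) : nth Flat p k = row_step (cell_row (g k)).
  by rewrite -(row_step_locate p k) -gP.
have g_inj : injective g.
  move=> k l kl; apply: val_inj; have := gP k; rewrite kl gP.
  rewrite /locate; case pk: nth; case pl: nth => //= -[e];
    by rewrite (before_inj _ pl _ pk (esym e)) ?size_tuple.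
have [|T gT Tg] := @inj_card_bij _ _ g g_inj.
  by rewrite card_ord card_cell.
have locT c : locate p (T c) = (cell_row c, cell_col c) by rewrite -gP Tg.
have stdT : is_syt [ffun c => T c].
  apply/and3P; split.
  - apply/forallP => k; apply/cards1P; exists (g k); apply/setP => c.
    by rewrite !inE ffunE; apply/eqP/eqP => [<-|->]; rewrite ?Tg ?gT.
  - apply/forallP => c; apply/forallP => d; apply/implyP => /andP[/eqP rcd ccd].
    by rewrite !ffunE; apply: (@locate_ltn_row p); rewrite !locT.
  - apply/forallP => c; apply/forallP => d; apply/implyP => /andP[/eqP ccd rcd].
    by rewrite !ffunE; apply: (@locate_ltn_col p); rewrite ?locT.
exists [ffun c => T c] => //; apply: eq_from_tnth => k.
have Tgk : [ffun c => T c] (g k) = k by rewrite ffunE gT.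
by rewrite !(tnth_nth Flat) -[in LHS]Tgk nth_row_word // gK.
Qed.

Lemma num_sytE : num_syt la =
  #|[set p : n.-tuple step | [&& ballot p, count_mem Up p == nth 0 la 0
                               & count_mem Down p == nth 0 la 1]]|.
Proof.
rewrite /num_syt -(card_in_imset row_word_inj); congr #|pred_of_set _|.
apply/setP => p; apply/imsetP/idP; rewrite !inE.
  case=> T; rewrite inE => stdT ->.
  by rewrite row_word_ballot // !(count_row_word _ (r := 0), count_row_word _ (r := 1)) ?eqxx.
case/and3P=> bp /eqP pU /eqP pD; have [T stdT <-] := row_word_onto bp pU pD.
by exists T; rewrite ?inE.
Qed.

End Tableaux.

(** * Summation over the shapes *)

Lemma num_syt_ballot n la : sorted geq la -> nth 0 la 2 <= 1 -> sumn la = n ->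
  num_syt la = \sum_(p : n.-tuple step)
    [&& ballot p, count_mem Up p == nth 0 la 0 & count_mem Down p == nth 0 la 1].
Proof.
move=> la_sorted la2 e; case: n / e; rewrite num_sytE // -sum1_card big_mkcond.
by apply: eq_bigr => p _; rewrite inE; case: ifP.
Qed.

Lemma partitions_eq n (t u : n.-tuple 'I_n.+1) :
  t \in partitions n -> nth 0 (parts t) 2 <= 1 ->
  u \in partitions n -> nth 0 (parts u) 2 <= 1 ->
  nth 0 (parts t) 0 = nth 0 (parts u) 0 ->
  nth 0 (parts t) 1 = nth 0 (parts u) 1 -> t = u.
Proof.
rewrite !inE => /andP[st /eqP sumt] t2 /andP[su /eqP sumu] u2 e0 e1.
have e : legs (parts t) = legs (parts u).
  by have := sumn_legs (parts t); have := sumn_legs (parts u); lia.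
apply/val_inj/(inj_map val_inj)/(@eq_from_nth _ 0); first by rewrite !size_map !size_tuple.
by move=> [|[|i]] _ //; rewrite [LHS]nth_legs // [RHS]nth_legs // e.
Qed.

Lemma ballot_flat (p : seq step) : ballot p ->
  0 < count_mem Flat p -> 0 < count_mem Down p.
Proof.
move=> bp; rewrite -has_count has_pred1 => pF.
have kp : index Flat p < size p by rewrite index_mem.
have := ballot_nth bp kp; rewrite /ballot_step nth_index // add0n => /leq_trans; apply.
by rewrite -[X in _ <= X]before_size leq_before // ltnW.
Qed.

(** The parts are the numbers of up-steps and down-steps, then a 1 per flat step; they decrease
    because [p] is a ballot word. *)
Lemma ballot_shape n (p : n.-tuple step) : ballot p ->
  exists2 t, (t \in partitions n) && (nth 0 (parts t) 2 <= 1) &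
    nth 0 (parts t) 0 = count_mem Up p /\ nth 0 (parts t) 1 = count_mem Down p.
Proof.
move=> bp; have := ballot_flat bp; have := ballot_le bp (leqnn _); rewrite !before_size.
have := count_steps p; rewrite size_tuple.
move: (count_mem Up p) (count_mem Down p) (count_mem Flat p) => u d f en le_du fd {p bp}.
pose F i := match i with 0 => u | 1 => d | i'.+2 => nat_of_bool (i' < f) end.
have Fn i : F i < n.+1 by case: i => [|[|i]] /=; lia.
pose t : n.-tuple 'I_n.+1 := [tuple Ordinal (Fn i) | i < n].
have tE i : nth 0 (parts t) i = F i.
  case: (ltnP i n) => [i_n|n_i].
    rewrite -[LHS](tnth_nth 0 (map_tuple val t) (Ordinal i_n)).
    by rewrite tnth_map tnth_mktuple.
  rewrite nth_default; last by rewrite size_map size_tuple.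
  (* [F] vanishes from index [n] on: a flat step forces [d] and [u] to be positive, so that
     [f + 2 <= n]. *)
  by case: i n_i => [|[|i]] /=; lia.
exists t; rewrite !tE; last by split.
rewrite inE /is_partition andbC /= leq_b1 /=.
apply/andP; split.
  apply/(sortedP 0) => i _; rewrite !tE.
  by case: i => [|[|i]] /=; lia.
rewrite sumnE (big_nth 0) size_map size_tuple big_mkord.
under eq_bigr do rewrite tE.
case: n en {t Fn tE} => [|[|n]] en; rewrite ?big_ord0 ?big_ord_recl /=.
- by [].
- by rewrite big_ord0; lia.
under eq_bigr do rewrite add0n.
rewrite sum_ltn; lia.
Qed.

(** After exchanging the sums, each ballot word fits exactly one shape. *)
Lemma S21E n : S21 n = \sum_(p : n.-tuple step) ballot_from 0 false p.
Proof.
pose fits (t : n.-tuple 'I_n.+1) (p : n.-tuple step) :=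
  (count_mem Up p == nth 0 (parts t) 0) && (count_mem Down p == nth 0 (parts t) 1).
transitivity (\sum_(t in partitions n | nth 0 (parts t) 2 <= 1)
                \sum_(p : n.-tuple step) (ballot p && fits t p)).
  apply: eq_bigr => t /andP[]; rewrite inE => /andP[st /eqP sumt] t2.
  exact: num_syt_ballot.
rewrite exchange_big; apply: eq_bigr => p _.
rewrite [in RHS](ballot_fromE p (leqnn 0)) -/(ballot p).
case bp: (ballot p); last by rewrite big1.
have [t Pt [t0 t1]] := ballot_shape bp.
rewrite (bigD1 t) //= /fits t0 t1 !eqxx big1 // => u /andP[/andP[Pu u2] ut].
case: eqP => //= e0; case: eqP => //= e1; case/andP: Pt => Pt t2.
by rewrite (partitions_eq Pu u2 Pt t2) ?eqxx // ?t0 ?t1 in ut.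
Qed.

Theorem theorem3p3 (n : nat) : ((HM n)%:Z = (S21 n)%:Z - 1 :> int)%R.
Proof.
rewrite HME S21E (big_morph Posz PoszD (erefl (Posz 0))) -/(ballot_words 0 false n).
by rewrite ballot_wordsE addrC addKr.
Qed.
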